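(* Let $(\mathcal{I},v)$ be a transferable utility coalitional game with $\mathcal{I}=\{1,\dots,N\}$ whose CORE $\mathcal{C}\subset\mathbb{R}^N$ is non-empty, and let $\beta\in[0,1)$. Let $\mathcal{T}:\mathbb{R}^{N^2}\to\mathbb{R}^{N^2}$ be given by $\mathcal{T}(\mathrm{col}(w_1,\dots,w_N))=\mathrm{col}(\mathcal{T}_1(w_1),\dots,\mathcal{T}_N(w_N))$ with $\mathcal{T}_i(w)=(1-\beta)\,\mathrm{proj}_{\mathcal{C}}(w)+\beta\,(2\,\mathrm{proj}_{\mathcal{C}}(w)-w)$ for $w\in\mathbb{R}^N$, $i\in\mathcal{I}$. Let $(\alpha_k)_k$ be a sequence with $\alpha_k\in(0,1)$ for all $k$, $\sum_{k}\alpha_k=\infty$ and $\sum_k\alpha_k^2<\infty$. For each $k\in\mathbb{N}$ let $A(k)=[a_{i,j}(k)]$ be an $N\times N$ doubly stochastic matrix with strictly positive diagonal elements, such that for some $\gamma>0$ independent of $k$, $a_{i,j}(k)\ge\gamma$ whenever $a_{i,j}(k)>0$; let $\boldsymbol{A}_k=A(k)\otimes I_N$. Then, for each $k\in\mathbb{N}$, the operator $\mathcal{S}_k:\mathbb{R}^{N^2}\to\mathbb{R}^{N^2}$, $$\mathcal{S}_k(\boldsymbol{w}) := (1-\alpha_k)\boldsymbol{A}_k\boldsymbol{w}+\alpha_k\boldsymbol{A}_k\mathcal{T}(\boldsymbol{w}),$$ is a paracontraction with respect to the Euclidean norm on $\mathbb{R}^{N^2}$.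
   Context: A transferable utility coalitional game is a pair $(\mathcal{I},v)$ with $\mathcal{I}=\{1,\dots,N\}$ and $v$ a function assigning a real value $v(S)$ to each $S\subseteq\mathcal{I}$, with $v(\varnothing)=0$. Its CORE is $$\mathcal{C}=\Big\{x\in\mathbb{R}^N \;\Big|\; \sum_{i\in\mathcal{I}}x_i=v(\mathcal{I}),\ \sum_{i\in S}x_i\ge v(S)\ \text{for all } S\subseteq\mathcal{I}\Big\},$$ a closed convex set, which is assumed non-empty. $\mathrm{proj}_{\mathcal{C}}(x)=\arg\min_{y\in\mathcal{C}}\|y-x\|$ is the Euclidean projection onto $\mathcal{C}$; $\mathrm{col}(\cdot)$ stacks vectors into one column vector; $\otimes$ is the Kronecker product and $I_N$ the $N\times N$ identity matrix. For a mapping $M:\mathbb{R}^n\to\mathbb{R}^n$, $\mathrm{fix}(M)=\{x\in\mathbb{R}^n\mid x=M(x)\}$. A continuous mapping $M:\mathbb{R}^n\to\mathbb{R}^n$ is a paracontraction with respect to a norm $\|\cdot\|$ if $\|M(x)-y\|<\|x-y\|$ for all $x\notin\mathrm{fix}(M)$ and $y\in\mathrm{fix}(M)$. *)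

(* Defs.v *)
From mathcomp Require Export all_boot all_order all_algebra.
From mathcomp Require Export all_classical all_reals all_analysis.
From mathcomp Require Export mxtens.

Set Implicit Arguments.
Unset Strict Implicit.
Unset Printing Implicit Defensive.

Import Order.TTheory GRing.Theory Num.Theory numFieldNormedType.Exports.

Local Open Scope classical_set_scope.
Local Open Scope ring_scope.

(* The norm that the libraries put on matrices is the max norm; on columns its
   topology is the usual (product) one, which is what [continuous] refers to
   below, but every metric notion goes through the following norm. *)
Definition enorm (R : realType) (n : nat) (x : 'cV[R]_n) : R :=
  Num.sqrt (\sum_i x i ord0 ^+ 2).

(* The players are 'I_N, i.e. they are numbered from 0. *)
Record tu_game (R : realType) (N : nat) := TUGame {
  value :> {set 'I_N} -> R;
  value_set0 : value finset.set0 = 0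
}.

Definition core (R : realType) (N : nat) (v : tu_game R N) : set 'cV[R]_N :=
  [set x : 'cV[R]_N | \sum_i x i ord0 = v [set: 'I_N]%SET /\
                      forall S : {set 'I_N}, v S <= \sum_(i in S) x i ord0].

Definition argmin (R : realType) (T : Type) (C : set T) (f : T -> R) : set T :=
  [set y | C y /\ forall z, C z -> f y <= f z].

(* When C is nonempty, closed and convex, the argmin is a singleton, so the
   choice made by [xget] is immaterial and its default value [x] is not used. *)
Definition proj (R : realType) (n : nat) (C : set 'cV[R]_n) (x : 'cV[R]_n)
    : 'cV[R]_n :=
  xget x (argmin C (fun y => enorm (y - x))).

Definition fix_set (T : Type) (M : T -> T) : set T := [set x | x = M x].

Definition paracontraction (R : realType) (n : nat) (nrm : 'cV[R]_n -> R)
    (M : 'cV[R]_n -> 'cV[R]_n) : Prop :=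
  continuous M /\
  forall x y, ~ fix_set M x -> fix_set M y -> nrm (M x - y) < nrm (x - y).

(* [stack] is col(w_1, ..., w_m): entry j of block i sits at position i * n + j,
   the indexing used by the Kronecker product [*t]. *)
Definition stack (R : realType) (m n : nat) (w : 'I_m -> 'cV[R]_n)
    : 'cV[R]_(m * n) :=
  \col_k w (mxtens_unindex k).1 (mxtens_unindex k).2 ord0.

Definition block (R : realType) (m n : nat) (w : 'cV[R]_(m * n)) (i : 'I_m)
    : 'cV[R]_n :=
  \col_j w (mxtens_index (i, j)) ord0.

Lemma stackK (R : realType) (m n : nat) (w : 'I_m -> 'cV[R]_n) (i : 'I_m) :
  block (stack w) i = w i.
Proof. by apply/colP => j; rewrite !mxE mxtens_indexK. Qed.

Lemma blockK (R : realType) (m n : nat) (w : 'cV[R]_(m * n)) :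
  stack (block w) = w.
Proof. by apply/colP => k; rewrite !mxE -surjective_pairing mxtens_unindexK. Qed.

Definition local_op (R : realType) (n : nat) (C : set 'cV[R]_n) (beta : R)
    (w : 'cV[R]_n) : 'cV[R]_n :=
  (1 - beta) *: proj C w + beta *: (2 *: proj C w - w).

Definition stacked_op (R : realType) (N : nat) (v : tu_game R N) (beta : R)
    (w : 'cV[R]_(N * N)) : 'cV[R]_(N * N) :=
  stack (fun i : 'I_N => local_op (core v) beta (block w i)).

Lemma stacked_op_stack (R : realType) (N : nat) (v : tu_game R N) (beta : R)
    (w : 'I_N -> 'cV[R]_N) :
  stacked_op v beta (stack w) = stack (fun i => local_op (core v) beta (w i)).
Proof. by rewrite /stacked_op; congr stack; apply/funext => i; rewrite stackK. Qed.

Definition doubly_stochastic (R : realType) (n : nat) (A : 'M[R]_n) : Prop :=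
  [/\ forall i j, 0 <= A i j,
      forall i, \sum_j A i j = 1 &
      forall j, \sum_i A i j = 1].

Definition iteration_op (R : realType) (n : nat) (a : R) (A : 'M[R]_n)
    (T : 'cV[R]_n -> 'cV[R]_n) (w : 'cV[R]_n) : 'cV[R]_n :=
  (1 - a) *: (A *m w) + a *: (A *m T w).

(* Main.v *)
(* Writing l = alpha_k (1 + beta), a number in (0, 2), the operator S_k is
   B \o G, where G applies the relaxed projection w |-> w + l (proj w - w) to
   each block and B = A(k) (x) I is again doubly stochastic with positive
   diagonal.  Firm nonexpansiveness of the projection makes G averaged, and the
   variance identity |x|^2 - |B x|^2 = sum_ij B_ij (x_j - (B x)_i)^2 shows that
   B strictly decreases the norm of every x with B x <> x.  As G and B have the
   common fixed point (c, ..., c) for any c in the core, a fixed point of B \o G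
   is fixed by both, and the strict inequality follows. *)
Require Import Defs.
From mathcomp Require Import ring lra.

Import Order.TTheory GRing.Theory Num.Theory numFieldNormedType.Exports.

Set Implicit Arguments.
Unset Strict Implicit.

Local Open Scope classical_set_scope.
Local Open Scope ring_scope.

(** * Inner product on columns and on stacked columns *)

Definition dot (R : realType) (n : nat) (u v : 'cV[R]_n) : R :=
  \sum_i u i ord0 * v i ord0.

Lemma dotC (R : realType) n (u v : 'cV[R]_n) : dot u v = dot v u.
Proof. by apply: eq_bigr => i _; rewrite mulrC. Qed.

Lemma dotDl (R : realType) n (u v w : 'cV[R]_n) :
  dot (u + v) w = dot u w + dot v w.
Proof. by rewrite -big_split; apply: eq_bigr => i _; rewrite mxE mulrDl. Qed.

Lemma dotZl (R : realType) n a (u w : 'cV[R]_n) : dot (a *: u) w = a * dot u w.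
Proof. by rewrite mulr_sumr; apply: eq_bigr => i _; rewrite mxE mulrA. Qed.

Lemma dotNl (R : realType) n (u w : 'cV[R]_n) : dot (- u) w = - dot u w.
Proof. by rewrite -scaleN1r dotZl mulN1r. Qed.

Lemma dotDr (R : realType) n (u v w : 'cV[R]_n) :
  dot w (u + v) = dot w u + dot w v.
Proof. by rewrite dotC dotDl !(dotC w). Qed.

Lemma dotZr (R : realType) n a (u w : 'cV[R]_n) : dot w (a *: u) = a * dot w u.
Proof. by rewrite dotC dotZl (dotC w). Qed.

Lemma dotNr (R : realType) n (u w : 'cV[R]_n) : dot w (- u) = - dot w u.
Proof. by rewrite dotC dotNl (dotC w). Qed.

Definition dotE := (dotDl, dotDr, dotZl, dotZr, dotNl, dotNr).

Lemma dot_ge0 (R : realType) n (u : 'cV[R]_n) : 0 <= dot u u.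
Proof. by apply: sumr_ge0 => i _; rewrite -expr2 sqr_ge0. Qed.

Lemma dot_eq0 (R : realType) n (u : 'cV[R]_n) : dot u u = 0 -> u = 0.
Proof.
move=> /eqP; rewrite psumr_eq0 => [/allP u0|i _]; last by rewrite -expr2 sqr_ge0.
apply/colP => i; rewrite mxE; apply/eqP; rewrite -sqrf_eq0 expr2.
by apply: (u0 i); rewrite mem_index_enum.
Qed.

Lemma coord_sqr_le_dot (R : realType) n (u : 'cV[R]_n) i :
  u i ord0 ^+ 2 <= dot u u.
Proof.
rewrite /dot (bigD1 i) //= expr2 lerDl sumr_ge0 // => j _.
by rewrite -expr2 sqr_ge0.
Qed.

Lemma enormE (R : realType) n (u : 'cV[R]_n) : enorm u = Num.sqrt (dot u u).
Proof. by congr Num.sqrt; apply: eq_bigr => i _; rewrite expr2. Qed.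

Lemma enorm_le (R : realType) n (u v : 'cV[R]_n) :
  (enorm u <= enorm v) = (dot u u <= dot v v).
Proof. by rewrite !enormE ler_sqrt // dot_ge0. Qed.

Lemma enorm_lt (R : realType) n (u v : 'cV[R]_n) :
  (enorm u < enorm v) = (dot u u < dot v v).
Proof. by rewrite !ltNge enorm_le. Qed.

Lemma sum_mxtens (R : realType) m n (F : 'I_(m * n) -> R) :
  \sum_k F k = \sum_i \sum_j F (mxtens_index (i, j)).
Proof.
rewrite pair_big /= (reindex (@mxtens_index m n)) /=.
  by apply: eq_bigr => -[].
by apply: onW_bij; exists (@mxtens_unindex m n) => k;
  rewrite ?mxtens_indexK ?mxtens_unindexK.
Qed.

Lemma dot_stack (R : realType) m n (w w' : 'I_m -> 'cV[R]_n) :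
  dot (stack w) (stack w') = \sum_i dot (w i) (w' i).
Proof.
rewrite /dot sum_mxtens; apply: eq_bigr => i _; apply: eq_bigr => j _.
by rewrite !mxE mxtens_indexK.
Qed.

(** * Continuity of nonexpansive maps *)

Lemma mx_continuous (R : realType) (T : topologicalType) m n
    (f : T -> 'M[R]_(m, n)) :
  (forall i j, continuous (fun x => f x i j)) -> continuous f.
Proof.
move=> fc x B [P Pn PB]; apply: (@filterS _ _ _ _ _ (fun y PY => PB (f y) PY)).
rewrite /=; apply: filter_forall => i; apply: filter_forall => j.
exact: fc (Pn i j).
Qed.

Lemma nonexpansive_continuous (R : realType) n (f : 'cV[R]_n -> 'cV[R]_n) :
  (forall x y, dot (f x - f y) (f x - f y) <= dot (x - y) (x - y)) ->
  continuous f.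
Proof.
move=> fne; apply: mx_continuous => i j x; rewrite ord1 {j}.
apply/(@cvgrPdist_lt _ _ _ _ (nbhs_filter x)) => e e0.
(* With every coordinate within [e / n.+1], the squared distance is at most [n * (e / n.+1) ^+ 2],
   which is below [e ^+ 2]; taking [n.+1] also covers [n = 0]. *)
have d0 : 0 < e / n.+1%:R by rewrite divr_gt0 // ltr0n.
near=> y.
have xy k : `|x k ord0 - y k ord0| < e / n.+1%:R.
  move: k; near: y; apply: filter_forall => k.
  have /(@cvgrPdist_lt _ _ _ _ (nbhs_filter x)) :=
    @coord_continuous R n 1 k ord0 x.
  exact.
rewrite -[ltRHS]gtr0_norm // -sqrtr_sqr -[ltRHS]sqrtr_sqr ltr_sqrt ?exprn_gt0 //.
have := coord_sqr_le_dot (f x - f y) i; rewrite !mxE => /le_lt_trans; apply.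
apply: (le_lt_trans (fne x y)).
apply: (@le_lt_trans _ _ (\sum_(k < n) (e / n.+1%:R) ^+ 2)).
  apply: ler_sum => k _; rewrite !mxE -expr2 -[leLHS]real_normK ?num_real //.
  by rewrite lerXn2r ?nnegrE ?(ltW d0) // ltW.
rewrite sumr_const card_ord -[ltLHS]mulr_natr expr_div_n -mulrA.
rewrite gtr_pMr ?exprn_gt0 // mulrC ltr_pdivrMr ?mul1r ?exprn_gt0 ?ltr0n //.
by rewrite -natrX ltr_nat (@leq_trans n.+1) // expnS leq_pmulr // expn_gt0.
Unshelve. all: by end_near. Qed.

(** * Projection onto a closed convex set *)

Lemma proj_exists (R : realType) n (C : set 'cV[R]_n) (x : 'cV[R]_n) :
  C !=set0 -> closed C -> argmin C (fun y => enorm (y - x)) (proj C x).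
Proof.
move=> [c0 Cc0] clC; apply: (@xgetPex _ x).
have trc : continuous (fun u : 'rV[R]_n => u^T).
  apply: mx_continuous => i j u.
  under [X in continuous_at _ X]eq_fun do rewrite mxE.
  exact: coord_continuous.
(* It suffices to minimize over the box [K], which contains the ball of radius [r] about [x]: points
   of [C] outside that ball are farther from [x] than [c0]. The transposes are there because
   [rV_compact] speaks of row vectors. *)
pose r := enorm (c0 - x).
pose K := [set u : 'rV[R]_n |
  forall i, `[x i ord0 - r, x i ord0 + r]%classic (u ord0 i)].
have KP y : enorm (y - x) <= r -> K y^T.
  move=> yr i /=; rewrite mxE in_itv /= -ler_distlC distrC.
  apply: le_trans yr; rewrite enormE -sqrtr_sqr ler_sqrt ?dot_ge0 //.
  by have := coord_sqr_le_dot (y - x) i; rewrite !mxE.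
pose f (u : 'rV[R]_n) := dot (u^T - x) (u^T - x).
have fc : continuous f.
  apply: continuous_big => [|i _ u]; first exact: add_continuous.
  have cu : continuous_at u (fun u : 'rV[R]_n => (u^T - x) i ord0).
    under [X in continuous_at _ X]eq_fun do rewrite !mxE.
    apply: (@continuousB _ _ _ (fun u : 'rV[R]_n => u ord0 i)).
      exact: coord_continuous.
    exact: cst_continuous.
  exact: (continuousM cu cu).
have K0 : K `&` (fun u => u^T) @^-1` C !=set0.
  by exists c0^T; split; [exact: KP|rewrite /= trmxK].
have cK : compact (K `&` (fun u => u^T) @^-1` C).
  apply: compact_closedI.
    apply: (@rV_compact R n (fun i => `[x i ord0 - r, x i ord0 + r]%classic)) => i.
    exact: segment_compact.
  by apply: preimage_closed => // u _; exact: trc.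
have [u] := compact_EVT_min K0 cK (continuous_subspaceT fc).
rewrite inE => -[Ku Cu] umin; exists u^T; split => // z Cz.
have fK y : C y -> enorm (y - x) <= r -> enorm (u^T - x) <= enorm (y - x).
  move=> Cy yr; have := umin y^T; rewrite /f trmxK enorm_le; apply.
  by rewrite inE; split; [exact: KP|rewrite /= trmxK].
have [zr|/ltW rz] := leP (enorm (z - x)) r; first exact: fK.
exact: le_trans (fK _ Cc0 (lexx _)) rz.
Qed.

Definition convex_col (R : realType) n (C : set 'cV[R]_n) : Prop :=
  forall y z (t : R), C y -> C z -> 0 <= t <= 1 -> C (y + t *: (z - y)).

Lemma proj_variational (R : realType) n (C : set 'cV[R]_n) (x c : 'cV[R]_n) :
  C !=set0 -> closed C -> convex_col C -> C c ->
  dot (x - proj C x) (c - proj C x) <= 0.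
Proof.
move=> C0 clC cvC Cc; have [] := proj_exists x C0 clC.
set p := proj C x => Cp pmin.
set a := x - p; set b := c - p.
(* Compare the projection p with the point p + t (c - p) of C, then let t be
   small: t = d / (d + q) suffices. *)
have ineq (t : R) : 0 <= t <= 1 -> 2 * t * dot a b <= t ^+ 2 * dot b b.
  move=> t01; have := pmin _ (cvC _ _ t Cp Cc t01); rewrite enorm_le.
  have -> : p + t *: b - x = t *: b - a by rewrite opprB addrA [p + _]addrC.
  rewrite -(opprB x p) -/a; move: a b => a b; rewrite !dotE (dotC b a); lra.
have := dot_ge0 b; move: (dot a b) (dot b b) ineq => d q ineq q0.
rewrite leNgt; apply/negP => d0.
have dq0 : 0 < d + q by lra.
have t0 : 0 < d / (d + q) by exact: divr_gt0.
have /ineq : 0 <= d / (d + q) <= 1.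
  by rewrite (ltW t0) ler_pdivrMr // mul1r; lra.
have : d / (d + q) * (d + q) = d by rewrite divfK // gt_eqF.
move: (d / (d + q)) t0 => t t0 td.
(* Cancelling [t] leaves [2 * d <= t * q], whereas [td] gives [t * q = d - t * d < d]. *)
rewrite mulrAC expr2 mulrC -mulrA ler_pM2l //; nra.
Qed.

Lemma proj_id (R : realType) n (C : set 'cV[R]_n) (c : 'cV[R]_n) :
  closed C -> C c -> proj C c = c.
Proof.
move=> clC Cc; have [_ /(_ _ Cc)] := proj_exists c (ex_intro _ _ Cc) clC.
rewrite subrr enorm_le.
have -> : dot (0 : 'cV[R]_n) 0 = 0.
  by rewrite /dot big1 // => i _; rewrite mxE mul0r.
move=> p0; apply/eqP; rewrite -subr_eq0; apply/eqP/dot_eq0/eqP.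
by rewrite eq_le p0 dot_ge0.
Qed.

(** Sum of the variational inequality at [x] tested with [proj C y] and the one at [y] tested with
    [proj C x]. *)
Lemma proj_firmly_nonexpansive (R : realType) n (C : set 'cV[R]_n)
    (x y : 'cV[R]_n) :
  C !=set0 -> closed C -> convex_col C ->
  dot (proj C x - proj C y) (proj C x - proj C y)
    <= dot (x - y) (proj C x - proj C y).
Proof.
move=> C0 clC cvC.
have [Cx _] := proj_exists x C0 clC; have [Cy _] := proj_exists y C0 clC.
have := proj_variational x C0 clC cvC Cy.
have := proj_variational y C0 clC cvC Cx.
move: (proj C x) (proj C y) => p q; rewrite !dotE (dotC q p); lra.
Qed.

(** * Averaged operators and relaxed projections *)

(** For [theta = (1 - s) / s] with [s] in (0, 1), this is the usual inequality characterizing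
    [s]-averaged operators. *)
Definition averaged (R : realType) (theta : R) n (G : 'cV[R]_n -> 'cV[R]_n) :
    Prop :=
  forall x y, dot (G x - G y) (G x - G y)
    + theta * dot (G x - x - (G y - y)) (G x - x - (G y - y))
    <= dot (x - y) (x - y).

Definition relax (R : realType) n (l : R) (P : 'cV[R]_n -> 'cV[R]_n)
  (x : 'cV[R]_n) : 'cV[R]_n := x + l *: (P x - x).

(** Put d = x - y and let e be the difference of the projections. The factor (2 - l) / l is chosen
    so that the left-hand side collapses to |d|^2 + 2 l (|e|^2 - <d, e>), and firm nonexpansiveness
    makes the last term nonpositive. *)
Lemma averaged_relax_proj (R : realType) n (C : set 'cV[R]_n) (l : R) :
  C !=set0 -> closed C -> convex_col C -> 0 < l ->
  averaged ((2 - l) / l) (relax l (proj C)).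
Proof.
move=> C0 clC cvC l0 x y.
have := proj_firmly_nonexpansive x y C0 clC cvC; rewrite /relax.
move: (proj C x) (proj C y) => p q firm.
have -> : x + l *: (p - x) - (y + l *: (q - y))
    = (x - y) + l *: ((p - q) - (x - y)).
  by apply/colP => i; rewrite !mxE; ring.
have -> : x + l *: (p - x) - x - (y + l *: (q - y) - y)
    = l *: ((p - q) - (x - y)).
  by apply/colP => i; rewrite !mxE; ring.
move: (x - y) (p - q) firm => d e firm.
rewrite [X in _ + _ * X]dotZl [X in _ + _ * (_ * X)]dotZr !mulrA divfK ?gt_eqF //.
have : l * dot e e <= l * dot d e by rewrite ler_pM2l.
rewrite !dotE (dotC e d); lra.
Qed.

Lemma stackB (R : realType) m n (w w' : 'I_m -> 'cV[R]_n) :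
  stack w - stack w' = stack (fun i => w i - w' i).
Proof. by apply/colP => k; rewrite !mxE. Qed.

Lemma averaged_stack (R : realType) m n theta (g : 'cV[R]_n -> 'cV[R]_n) :
  averaged theta g ->
  averaged theta
    (fun w : 'cV[R]_(m * n) => stack (fun i : 'I_m => g (block w i))).
Proof.
move=> gav x y.
have -> : x - y = stack (fun i => block x i - block y i).
  by rewrite -stackB !blockK.
set Gx := stack _; set Gy := stack _.
have -> : Gx - x - (Gy - y) = stack (fun i =>
    g (block x i) - block x i - (g (block y i) - block y i)).
  by rewrite -!stackB !blockK.
rewrite stackB !dot_stack mulr_sumr -big_split ler_sum // => i _.
exact: gav.
Qed.

(** * Doubly stochastic matrices and the Euclidean norm *)

(** Row i is a probability vector under which x has mean (B x)_i, so its inner sum is a variance: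
    second moment minus squared mean. Unit column sums make the second moments add up to |x|^2. *)
Lemma doubly_stochastic_variance (R : realType) n (B : 'M[R]_n) (x : 'cV[R]_n) :
  doubly_stochastic B ->
  dot x x = dot (B *m x) (B *m x)
    + \sum_i \sum_j B i j * (x j ord0 - (B *m x) i ord0) ^+ 2.
Proof.
move=> [_ Br Bc]; set y := B *m x.
have yE i : \sum_j B i j * x j ord0 = y i ord0 by rewrite [RHS]mxE.
have -> : dot x x = \sum_i \sum_j B i j * x j ord0 ^+ 2.
  rewrite exchange_big; apply: eq_bigr => j _.
  by rewrite -mulr_suml Bc mul1r expr2.
rewrite -big_split; apply: eq_bigr => i _ /=.
have -> : \sum_j B i j * (x j ord0 - y i ord0) ^+ 2
    = \sum_j (B i j * x j ord0 ^+ 2 - 2 * y i ord0 * (B i j * x j ord0)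
              + y i ord0 ^+ 2 * B i j).
  by apply: eq_bigr => j _; ring.
rewrite big_split sumrB /= -!mulr_sumr yE Br; ring.
Qed.

Lemma doubly_stochastic_nonexpansive (R : realType) n (B : 'M[R]_n)
    (x : 'cV[R]_n) :
  doubly_stochastic B -> dot (B *m x) (B *m x) <= dot x x.
Proof.
move=> Bds; rewrite [leRHS](doubly_stochastic_variance x Bds) lerDl.
have [B0 _ _] := Bds.
by apply: sumr_ge0 => i _; apply: sumr_ge0 => j _; rewrite mulr_ge0 ?sqr_ge0.
Qed.

Lemma doubly_stochastic_isometric (R : realType) n (B : 'M[R]_n)
    (x : 'cV[R]_n) :
  doubly_stochastic B -> (forall i, 0 < B i i) ->
  dot x x <= dot (B *m x) (B *m x) -> B *m x = x.
Proof.
move=> Bds Bd; rewrite [leLHS](doubly_stochastic_variance x Bds) gerDl => le0.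
have [B0 _ _] := Bds.
have term_ge0 i j : 0 <= B i j * (x j ord0 - (B *m x) i ord0) ^+ 2.
  by rewrite mulr_ge0 ?sqr_ge0.
apply/colP => i; apply/eqP; rewrite eq_sym -subr_eq0 -sqrf_eq0.
rewrite -(mulrI_eq0 _ (lregP (lt0r_neq0 (Bd i)))) eq_le term_ge0 andbT.
apply: le_trans le0.
(* Only the diagonal term (i, i) of the variance is kept; its weight [B i i] is positive, so its
   square vanishes. *)
rewrite (bigD1 i) //= (bigD1 i (F := fun j => B i j * _)) //= -addrA lerDl.
by rewrite addr_ge0 // sumr_ge0 // => k _; rewrite sumr_ge0.
Qed.

(** * Composition of an averaged operator with a doubly stochastic matrix *)

Lemma paracontraction_averaged (R : realType) n (B : 'M[R]_n) theta
    (G : 'cV[R]_n -> 'cV[R]_n) (z : 'cV[R]_n) :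
  doubly_stochastic B -> (forall i, 0 < B i i) ->
  0 < theta -> averaged theta G -> G z = z -> B *m z = z ->
  paracontraction (@enorm R n) (fun x => B *m G x).
Proof.
move=> Bds Bd th0 Gav Gz Bz.
have BG x y : dot (B *m G x - B *m G y) (B *m G x - B *m G y)
    <= dot (G x - G y) (G x - G y).
  by rewrite -mulmxBr doubly_stochastic_nonexpansive.
have Gne x y : dot (G x - G y) (G x - G y) <= dot (x - y) (x - y).
  by apply: le_trans (Gav x y); rewrite lerDl mulr_ge0 ?dot_ge0 // ltW.
(* The chain |x - y|^2 <= |B G x - y|^2 <= |G x - y|^2 <= |x - y|^2 - theta |G x - x|^2 forces G x =
   x; then B preserves the norm of x - y, hence fixes it. *)
have GB x y : G y = y -> B *m y = y ->
    dot (x - y) (x - y) <= dot (B *m G x - y) (B *m G x - y) ->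
    G x = x /\ B *m x = x.
  move=> Gy By le_xy.
  have Gx : G x = x.
    apply/eqP; rewrite -subr_eq0; apply/eqP/dot_eq0/eqP.
    rewrite eq_le dot_ge0 andbT -(pmulr_rle0 _ th0).
    have := Gav x y; have := BG x y; rewrite Gy By subrr subr0; lra.
  split=> //; have := doubly_stochastic_isometric Bds Bd (x := x - y).
  rewrite mulmxBr By => /(_ _)/addIr; apply.
  by move: le_xy; rewrite Gx.
split; first by apply: nonexpansive_continuous => x y; exact: le_trans (BG x y) _.
move=> x y; rewrite /fix_set /= => xfix yfix.
(* For a fixed point [y] of the composition, the norm hypothesis of [GB] relative to [z] is an
   equality. *)
have [Gy By] : G y = y /\ B *m y = y by apply: (GB _ z); rewrite -?yfix.
rewrite enorm_lt ltNge; apply/negP => /(GB _ _ Gy By)[Gx Bx].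
by apply: xfix; rewrite Gx.
Qed.

(** * Kronecker product with the identity *)

Lemma sum_scalar1_row (R : realType) n (j : 'I_n) (F : 'I_n -> R) :
  \sum_l (1%:M : 'M[R]_n) j l * F l = F j.
Proof.
rewrite (bigD1 j) //= big1 => [|l lj]; first by rewrite mxE eqxx mul1r addr0.
by rewrite mxE eq_sym (negPf lj) mul0r.
Qed.

Lemma tens1_stack_cst (R : realType) m n (A : 'M[R]_m) (c : 'cV[R]_n) :
  (forall i, \sum_j A i j = 1) ->
  (A *t (1%:M : 'M[R]_n)) *m stack (fun=> c) = stack (fun=> c).
Proof.
move=> Ar; apply/colP => k; case: (mxtens_indexP k) => i j.
rewrite mxE sum_mxtens [RHS]mxE mxtens_indexK /=.
have -> : c j ord0 = \sum_i' A i i' * c j ord0 by rewrite -mulr_suml Ar mul1r.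
apply: eq_bigr => i' _; rewrite -(sum_scalar1_row j (c^~ ord0)) mulr_sumr.
by apply: eq_bigr => l _; rewrite tensmxE !mxE mxtens_indexK mulrA.
Qed.

(** Unit row sums amount to fixing the all-ones column, which is a stack of equal blocks. *)
Lemma tens1_row_sum (R : realType) m n (A : 'M[R]_m) :
  (forall i, \sum_j A i j = 1) ->
  forall k, \sum_l (A *t (1%:M : 'M[R]_n)) k l = 1.
Proof.
move=> Ar k; have /colP/(_ k) := tens1_stack_cst (const_mx 1 : 'cV[R]_n) Ar.
rewrite mxE [RHS]mxE [RHS]mxE => E; rewrite -[RHS]E; apply: eq_bigr => l _.
by rewrite [stack _ l _]mxE [const_mx _ _ _]mxE mulr1.
Qed.

Lemma doubly_stochastic_tens1 (R : realType) m n (A : 'M[R]_m) :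
  doubly_stochastic A -> doubly_stochastic (A *t (1%:M : 'M[R]_n)).
Proof.
move=> [A0 Ar Ac]; split=> [k l||l]; last 2 first.
- exact: tens1_row_sum.
(* Column sums are row sums of the transpose, which is [A^T *t 1%:M]. *)
- have ATr i : \sum_j A^T i j = 1.
    by rewrite -[RHS](Ac i); apply: eq_bigr => j _; rewrite mxE.
  rewrite -[RHS](tens1_row_sum (n := n) ATr l) -[in RHS](trmx1 R n) -trmx_tens.
  by apply: eq_bigr => k _; rewrite [RHS]mxE.
by rewrite mxE mulr_ge0 // mxE ler0n.
Qed.

Lemma tens1_diag_gt0 (R : realType) m n (A : 'M[R]_m) :
  (forall i, 0 < A i i) -> forall k, 0 < (A *t (1%:M : 'M[R]_n)) k k.
Proof. by move=> Ad k; rewrite mxE mxE eqxx mulr1. Qed.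

(** * Convexity and closedness of the core *)

Lemma sum_setT (R : realType) n (F : 'I_n -> R) :
  \sum_(i in [set: 'I_n]%SET) F i = \sum_i F i.
Proof. by apply: eq_bigl => i; rewrite inE. Qed.

Lemma core_convex (R : realType) N (v : tu_game R N) : convex_col (core v).
Proof.
move=> y z t [y1 yS] [z1 zS] /andP[t0 t1].
have sumE (S : {set 'I_N}) : \sum_(i in S) (y + t *: (z - y)) i ord0
    = (1 - t) * \sum_(i in S) y i ord0 + t * \sum_(i in S) z i ord0.
  rewrite !mulr_sumr -big_split; apply: eq_bigr => i _ /=; rewrite !mxE; ring.
split=> [|S].
  by rewrite -sum_setT sumE !sum_setT y1 z1 -mulrDl subrK mul1r.
by rewrite sumE; have := yS S; have := zS S; nra.
Qed.

Lemma core_closed (R : realType) N (v : tu_game R N) : closed (core v).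
Proof.
pose sum (S : {set 'I_N}) (x : 'cV[R]_N) := \sum_(i in S) x i ord0.
have sumc S : continuous (sum S).
  apply: continuous_big => [|i _]; first exact: add_continuous.
  exact: coord_continuous.
(* The core is a hyperplane intersected with closed half-spaces, all given by the continuous maps
   [sum S]. *)
have -> : core v = (sum [set: 'I_N]%SET @^-1` [set v [set: 'I_N]%SET])
    `&` \bigcap_S (sum S @^-1` [set a | v S <= a]).
  apply/seteqP; split=> x /= -[x1 xS].
    by split=> [|S _]; [rewrite /sum sum_setT|exact: xS].
  by split=> [|S]; [rewrite -sum_setT|exact: xS].
apply: closedI.
  by apply: preimage_closed => [x _|]; [exact: sumc|exact: closed_eq].
apply: closed_bigI => S _.
by apply: preimage_closed => [x _|]; [exact: sumc|exact: closed_ge].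
Qed.

(** * The iteration operator *)

(** Blockwise T_i(w) - w = (1 + beta) (proj w - w), so mixing w and T_i(w) with weight [a] is a
    relaxation with parameter [a * (1 + beta)]. *)
Lemma iteration_opE (R : realType) N (v : tu_game R N) a beta
    (B : 'M[R]_(N * N)) :
  iteration_op a B (stacked_op v beta) =
  (fun w => B *m stack (fun i : 'I_N =>
     relax (a * (1 + beta)) (proj (core v)) (block w i))).
Proof.
apply/funext => w; rewrite /iteration_op !scalemxAr -mulmxDr; congr (_ *m _).
apply/colP => k; rewrite !mxE -surjective_pairing mxtens_unindexK; ring.
Qed.

Theorem corollary1 (R : realType) (N : nat) (v : tu_game R N)
    (core_neq0 : core v !=set0)
    (beta : R) (beta_ge0 : 0 <= beta) (beta_lt1 : beta < 1)
    (alpha : nat -> R)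
    (alpha01 : forall k, 0 < alpha k < 1)
    (alpha_sum : (\sum_(0 <= k <oo) (alpha k)%:E = +oo)%E)
    (alpha2_sum : (\sum_(0 <= k <oo) (alpha k ^+ 2)%:E < +oo)%E)
    (A : nat -> 'M[R]_N)
    (A_ds : forall k, doubly_stochastic (A k))
    (A_diag : forall k i, 0 < A k i i)
    (gamma : R) (gamma_gt0 : 0 < gamma)
    (A_gamma : forall k i j, 0 < A k i j -> gamma <= A k i j) :
  forall k : nat,
    paracontraction (@enorm R (N * N))
      (iteration_op (alpha k) (A k *t (1%:M : 'M[R]_N)) (stacked_op v beta)).
Proof.
move=> k; have [c cc] := core_neq0; have /andP[a0 a1] := alpha01 k.
have l0 : 0 < alpha k * (1 + beta) by rewrite mulr_gt0 //; lra.
(* Both [alpha k < 1] and [1 + beta < 2] enter here; this bound makes the averagedness constant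
   positive. *)
have l2 : alpha k * (1 + beta) < 2 by nra.
rewrite iteration_opE.
apply: (@paracontraction_averaged _ _ _
  ((2 - alpha k * (1 + beta)) / (alpha k * (1 + beta))) _ (stack (fun=> c))).
- exact: doubly_stochastic_tens1.
- exact: tens1_diag_gt0.
- by rewrite divr_gt0 // subr_gt0.
- apply/averaged_stack/averaged_relax_proj => //.
    exact: core_closed.
  exact: core_convex.
- congr stack; apply/funext => i.
  by rewrite stackK /relax proj_id ?subrr ?scaler0 ?addr0 //; exact: core_closed.
- by have [_ Ar _] := A_ds k; exact: tens1_stack_cst.
Qed.
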